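(* Let $p$ be an odd prime, let $r$ be an integer with $1\le r<p$, and let $a\in\mathbb{Z}_p$ be such that $a\not\equiv 0\pmod p$ and $a\not\equiv (r-1)^{r-1}/r^r\pmod p$. If the polynomial $a(c-1)^r+c^{r-1}$, viewed in $\mathbb{F}_p[c]$ (with $a$ reduced modulo $p$), factors completely into linear factors in $\mathbb{F}_p[c]$, then $$\sum_{0<k<p}\binom{rk}{k}a^k\equiv 0\pmod p\qquad\text{and}\qquad\sum_{0<k<p/r}\binom{rk}{k}a^k\equiv 0\pmod p.$$
   Context: $\mathbb{Z}_p$ is the ring of $p$-adic integers and $\mathbb{F}_p$ the field of $p$ elements. When $r=1$, the expression $(r-1)^{r-1}$ is read as $0^0=1$. *)

(* Defs.v *)
From HB Require Import structures.
From mathcomp Require Import all_boot all_order all_algebra.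
From mathcomp Require Import boolp.

Set Implicit Arguments.
Unset Strict Implicit.
Unset Printing Implicit Defensive.

Import GRing.Theory.
Local Open Scope ring_scope.

(* The reduction Z/n -> Z/m, a ring morphism only when m divides n. *)
Definition Zp_red (m n : nat) (x : 'Z_n) : 'Z_m := (x : nat)%:R.

Section ZpRed.
Variables (m n : nat).
Hypothesis dvd_mn : ((Zp_trunc m).+2 %| (Zp_trunc n).+2)%N.

Lemma Zp_red_nat k : Zp_red m (k%:R : 'Z_n) = k%:R.
Proof. by apply: val_inj; rewrite /Zp_red !Zp_nat /= modn_dvdm. Qed.

Lemma Zp_red0 : Zp_red m (0 : 'Z_n) = 0.
Proof. exact: Zp_red_nat 0. Qed.

Lemma Zp_red1 : Zp_red m (1 : 'Z_n) = 1.
Proof. exact: Zp_red_nat 1. Qed.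

Lemma Zp_redD : {morph @Zp_red m n : x y / x + y}.
Proof.
by move=> x y; rewrite -[x]natr_Zp -[y]natr_Zp -natrD !Zp_red_nat natrD.
Qed.

Lemma Zp_redM : {morph @Zp_red m n : x y / x * y}.
Proof.
by move=> x y; rewrite -[x]natr_Zp -[y]natr_Zp -natrM !Zp_red_nat natrM.
Qed.

Lemma Zp_redN : {morph @Zp_red m n : x / - x}.
Proof. by move=> x; apply: (addIr (Zp_red m x)); rewrite -Zp_redD !addNr Zp_red0. Qed.

End ZpRed.

(* Z_p as the inverse limit of the rings Z/p^(n+1), with n : nat.  The exponent
   starts at 1 because 'Z_1 is Z/2 instead of the zero ring.  The type is only
   meaningful for 1 < p, but it is a commutative ring for every p. *)
Record padic_int (p : nat) := PadicInt {
  padic_approx : forall n, 'Z_(p ^ n.+1);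
  padic_coherent :
    forall n, Zp_red (p ^ n.+1) (padic_approx n.+1) = padic_approx n
}.

HB.instance Definition _ (p : nat) := gen_eqMixin (padic_int p).
HB.instance Definition _ (p : nat) := gen_choiceMixin (padic_int p).

Section PadicRing.
Variable p : nat.
Implicit Types x y z : padic_int p.

Lemma padic_eq x y : (forall n, padic_approx x n = padic_approx y n) -> x = y.
Proof.
case: x y => [x hx] [y hy] /= exy.
have {}exy : x = y by apply: functional_extensionality_dep.
by case: y / exy hy => hy; congr PadicInt; apply: Prop_irrelevance.
Qed.

Lemma padic_dvd n :
  ((Zp_trunc (p ^ n.+1)).+2 %| (Zp_trunc (p ^ n.+2)).+2)%N.
Proof.
have [p_gt1|] := ltnP 1 p; last first.
  by case: p => [|[|//]] _; rewrite ?exp0n ?exp1n.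
by rewrite !Zp_cast ?(ltn_exp2l 0) ?dvdn_exp2l.
Qed.

Definition padic_zero : padic_int p :=
  @PadicInt p (fun=> 0) (fun n => Zp_red0 (padic_dvd n)).

Definition padic_one : padic_int p :=
  @PadicInt p (fun=> 1) (fun n => Zp_red1 (padic_dvd n)).

Lemma padic_opp_coherent x n :
  Zp_red (p ^ n.+1) (- padic_approx x n.+1) = - padic_approx x n.
Proof. by rewrite (Zp_redN (padic_dvd n)) padic_coherent. Qed.

Lemma padic_add_coherent x y n :
  Zp_red (p ^ n.+1) (padic_approx x n.+1 + padic_approx y n.+1) =
  padic_approx x n + padic_approx y n.
Proof. by rewrite (Zp_redD (padic_dvd n)) !padic_coherent. Qed.

Lemma padic_mul_coherent x y n :
  Zp_red (p ^ n.+1) (padic_approx x n.+1 * padic_approx y n.+1) =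
  padic_approx x n * padic_approx y n.
Proof. by rewrite (Zp_redM (padic_dvd n)) !padic_coherent. Qed.

Definition padic_opp x := PadicInt (padic_opp_coherent x).
Definition padic_add x y := PadicInt (padic_add_coherent x y).
Definition padic_mul x y := PadicInt (padic_mul_coherent x y).

Lemma padic_addA : associative padic_add.
Proof. by move=> x y z; apply: padic_eq => n; apply: addrA. Qed.

Lemma padic_addC : commutative padic_add.
Proof. by move=> x y; apply: padic_eq => n; apply: addrC. Qed.

Lemma padic_add0 : left_id padic_zero padic_add.
Proof. by move=> x; apply: padic_eq => n; apply: add0r. Qed.

Lemma padic_addN : left_inverse padic_zero padic_opp padic_add.
Proof. by move=> x; apply: padic_eq => n; apply: addNr. Qed.

HB.instance Definition _ := GRing.isZmodule.Build (padic_int p)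
  padic_addA padic_addC padic_add0 padic_addN.

Lemma padic_mulA : associative padic_mul.
Proof. by move=> x y z; apply: padic_eq => n; apply: mulrA. Qed.

Lemma padic_mulC : commutative padic_mul.
Proof. by move=> x y; apply: padic_eq => n; apply: mulrC. Qed.

Lemma padic_mul1 : left_id padic_one padic_mul.
Proof. by move=> x; apply: padic_eq => n; apply: mul1r. Qed.

Lemma padic_mulDl : left_distributive padic_mul +%R.
Proof. by move=> x y z; apply: padic_eq => n; apply: mulrDl. Qed.

Lemma padic_oner_neq0 : padic_one != 0.
Proof. by apply/eqP => /(congr1 (fun x => padic_approx x 0)) /eqP; rewrite oner_eq0. Qed.

HB.instance Definition _ := GRing.Zmodule_isComNzRing.Build (padic_int p)
  padic_mulA padic_mulC padic_mul1 padic_mulDl padic_oner_neq0.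

Definition padic_unit : {pred padic_int p} :=
  fun x => `[< exists y, y * x = 1 >].

Definition padic_inv x : padic_int p :=
  if pselect (exists y, y * x = 1) is left ex then sval (cid ex) else x.

Lemma padic_mulVx : {in padic_unit, left_inverse 1 padic_inv *%R}.
Proof.
move=> x /asboolP ux; rewrite /padic_inv; case: pselect => // ex.
by case: (cid ex).
Qed.

Lemma padic_unitPl x y : y * x = 1 -> padic_unit x.
Proof. by move=> yx; apply/asboolP; exists y. Qed.

Lemma padic_invr_out : {in [predC padic_unit], padic_inv =1 id}.
Proof.
move=> x; rewrite inE => /asboolPn nux.
by rewrite /padic_inv; case: pselect.
Qed.

HB.instance Definition _ := GRing.ComNzRing_hasMulInverse.Build (padic_int p)
  padic_mulVx padic_unitPl padic_invr_out.

(* Congruence modulo the ideal p Z_p. *)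
Definition padic_eqmodp x y := exists z, x - y = p%:R * z.

Definition padic_residue x : 'F_p := Zp_red (pdiv p) (padic_approx x 0).

Lemma padic_residue_dvd :
  ((Zp_trunc (pdiv p)).+2 %| (Zp_trunc (p ^ 1)).+2)%N.
Proof.
have [p_gt1|] := ltnP 1 p; last by case: p => [|[|m]]; rewrite ?expn1.
rewrite expn1 [X in (_ %| X)%N]Zp_cast // Zp_cast ?pdiv_dvd //.
by rewrite prime_gt1 ?pdiv_prime.
Qed.

Lemma padic_residue_is_zmod_morphism : zmod_morphism padic_residue.
Proof.
move=> x y.
by rewrite /padic_residue (Zp_redD padic_residue_dvd) (Zp_redN padic_residue_dvd).
Qed.

Lemma padic_residue_is_monoid_morphism : monoid_morphism padic_residue.
Proof.
split; first exact: Zp_red1 padic_residue_dvd.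
by move=> x y; apply: Zp_redM padic_residue_dvd _ _.
Qed.

HB.instance Definition _ := GRing.isZmodMorphism.Build
  (padic_int p) 'F_p padic_residue padic_residue_is_zmod_morphism.
HB.instance Definition _ := GRing.isMonoidMorphism.Build
  (padic_int p) 'F_p padic_residue padic_residue_is_monoid_morphism.

End PadicRing.

(* Main.v *)
Require Import Defs.
From mathcomp Require Import all_boot all_order all_algebra.
From mathcomp Require Import separable finfield ring zify.
Set Implicit Arguments.
Unset Strict Implicit.
Unset Printing Implicit Defensive.
Import GRing.Theory Num.Theory.
Local Open Scope ring_scope.

(** Everything takes place in F_p, with [a] the residue.  The reason for the
    result is periodicity: when D divides X^(p-1) - 1, the power series 1/D has
    period p-1, so that its coefficients in degrees 0 and p-1 agree.

    The splitting polynomial Q(c) = a(c-1)^r + c^(r-1) has degree r.  The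
    discriminant condition on [a] makes it separable, and the two conditions on
    [a] prevent c = 0 from being a root, so Q has r distinct nonzero roots z
    ([trinomial_split_roots]).  Then every D_t = a(X+t)^r - (X+t) + 1 has the r
    distinct roots 1 - 1/z - t in F_p, and as soon as D_t(0) <> 0, Fermat's
    little theorem gives D_t | X^(p-1) - 1 ([dvdp_trinomial]).  The two sums, each
    completed by its term 1 for k = 0, are read off from t = 1 and t = 0.

    - Long sum.  C(rk,k) is the coefficient of X^k in (1+X)^(rk).  So the sum of
      C(rk,k) a^k over k < p is the coefficient of degree p-1 in the geometric
      sum of the A^(p-1-i) X^i, where A = a(1+X)^r.  That geometric sum is
      (A^p - X^p) / (A - X), whose denominator is D_1 and whose numerator is, by
      Frobenius, congruent to the constant a modulo X^p.  By periodicity the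
      coefficient equals the constant coefficient a^(p-1) = 1.

    - Short sum.  For rk < p, reflecting the upper index modulo p gives
      C(rk,k) = (-1)^k C(p-1-(r-1)k, k), and these are the terms of the
      coefficient of degree p-1 in the geometric series of u = X - aX^r, that is
      in 1/(1-u) = 1/D_0.  The terms with rk >= p vanish by themselves, which is
      where the truncation k < p/r comes from.  By periodicity the coefficient
      equals the constant coefficient 1. *)

(** * Congruences between p-adic integers *)

Lemma padic_approx_natr p k n :
  padic_approx (k%:R : padic_int p) n = k%:R.
Proof. by elim: k => // k IH; rewrite !mulrSr -IH. Qed.

(** The kernel of the residue map is p Z_p.  Dividing d by p shifts the inverse
    system: d/p modulo p^(n+1) is only determined by d modulo p^(n+2). *)
Lemma padic_eqmodp_residue p (x y : padic_int p) : prime p ->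
  padic_residue x = padic_residue y -> padic_eqmodp x y.
Proof.
move=> p_pr /eqP; rewrite -subr_eq0 -rmorphB /=; set d := x - y => /eqP d0.
have p_gt1 := prime_gt1 p_pr.
have pn_gt1 n : (1 < p ^ n.+1)%N by rewrite (ltn_exp2l 0).
pose v n : nat := padic_approx d n.
have v_cong n : (v n.+1 %% p ^ n.+1 = v n)%N.
  by rewrite /v -(padic_coherent d n) /Zp_red val_Zp_nat.
have p_dvd_v n : (p %| v n)%N.
  elim: n => [|n IHn].
    have /= := congr1 val d0; rewrite /padic_residue /Zp_red -/(v 0).
    by rewrite val_Fp_nat // => /eqP.
  by rewrite (divn_eq (v n.+1) (p ^ n.+1)) v_cong dvdn_add // dvdn_mull // dvdn_exp.
have z_coh n : Zp_red (p ^ n.+1) ((v n.+2 %/ p)%:R : 'Z_(p ^ n.+2)) =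
  (v n.+1 %/ p)%:R.
  rewrite (Zp_red_nat (padic_dvd p n)) (divn_eq (v n.+2) (p ^ n.+2)) v_cong.
  rewrite [X in (_ * X + _)%N]expnSr mulnA divnMDl ?(ltnW p_gt1) // natrD natrM.
  by rewrite (pchar_Zp (pn_gt1 n)) mulr0 add0r.
exists (PadicInt z_coh); apply: padic_eq => n.
rewrite -/d; change (padic_approx d n = padic_approx p%:R n * (v n.+1 %/ p)%:R).
rewrite padic_approx_natr -natrM mulnC divnK //.
by rewrite -(padic_coherent d n).
Qed.

(** This makes the quotient by r^r in the statement a genuine quotient: the
    inverse of a non-unit would be the element itself. *)
Lemma padic_natr_unit p k : prime p -> (0 < k < p)%N ->
  (k%:R : padic_int p) \is a GRing.unit.
Proof.
move=> p_pr /andP[k_gt0 k_lt].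
have p_gt1 := prime_gt1 p_pr.
have k_unit n : (k%:R : 'Z_(p ^ n.+1)) \is a GRing.unit.
  rewrite unitZpE ?(ltn_exp2l 0) // coprimeXl // prime_coprime //.
  by rewrite gtnNdvd.
have inv_coh n :
    Zp_red (p ^ n.+1) ((k%:R)^-1 : 'Z_(p ^ n.+2)) = (k%:R)^-1.
  apply: (mulrI (k_unit n)); rewrite (mulrV (k_unit n)).
  rewrite -{1}(Zp_red_nat (padic_dvd p n)) -(Zp_redM (padic_dvd p n)).
  by rewrite (mulrV (k_unit n.+1)) (Zp_red1 (padic_dvd p n)).
apply/unitrPr; exists (PadicInt inv_coh); apply: padic_eq => n.
change (padic_approx k%:R n * (k%:R)^-1 = 1 :> 'Z_(p ^ n.+1)).
rewrite padic_approx_natr; exact: mulrV (k_unit n).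
Qed.

(** * Periodicity of the inverse of a divisor of X^n - 1 *)

(** Here W agrees with c/D up to degree n.  Writing X^n - 1 = T D gives
    (X^n - 1) W = c T modulo X^(n+1), and T has degree less than n because D is
    not constant, so the coefficient of degree n on the right is 0. *)
Lemma coef_period (F : fieldType) (n : nat) (c : F) (D W U : {poly F}) :
  (1 < size D)%N -> D %| 'X^n - 1 -> D * W = c%:P + 'X^(n.+1) * U ->
  W`_n = W`_0.
Proof.
case: n => [//|n] D_gt1 /dvdpP[T defT] DW.
have D_neq0 : D != 0 by rewrite -size_poly_eq0 -lt0n ltnW.
have szT : (size T <= n.+1)%N.
  have [->|T_neq0] := eqVneq T 0; first by rewrite size_poly0.
  have := congr1 (size : {poly F} -> nat) defT; rewrite size_mul //.
  rewrite size_XnsubC // //.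
  move: D_gt1; case: (size D) => [|[|d]] // _; rewrite !addnS /= => -[->].
  exact: leq_addr.
have := congr1 (fun P : {poly F} => P`_n.+1) (congr1 ( *%R T) DW).
rewrite mulrA -defT mulrBl mul1r mulrDr mulrCA !coefB !coefD !coefXnM.
rewrite ltnn subnn ltnSn coefMC (nth_default _ szT) mul0r addr0.
by move/subr0_eq.
Qed.

(** * Roots of the trinomial over a prime field *)

Section PrimeField.
Variables (F : finFieldType) (p : nat).
Hypotheses (p_char : p \in [pchar F]) (F_card : #|F| = p).

Let p_pr : prime p := pcharf_prime p_char.

(** A polynomial with as many distinct roots as its degree allows is a constant
    times the product over these roots; if they are nonzero, they are among the
    roots of X^(p-1) - 1. *)
Lemma dvdp_unity_of_roots (D : {poly F}) (s : seq F) :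
  (size D <= (size s).+1)%N -> uniq s -> all (root D) s -> D.[0] != 0 ->
  (size D = (size s).+1) /\ D %| 'X^(p.-1) - 1.
Proof.
move=> szD s_uniq s_root D0.
have D_neq0 : D != 0 by apply: contraNneq D0 => ->; rewrite horner0.
have {}szD : size D = (size s).+1.
  by apply/eqP; rewrite eqn_leq szD max_poly_roots.
split=> //.
have s_uroots : uniq_roots s by rewrite uniq_rootsE.
rewrite (all_roots_prod_XsubC szD s_root s_uroots).
rewrite dvdpZl ?lead_coef_eq0 //; apply: uniq_roots_dvdp => //.
apply/allP=> x /(allP s_root) Dx.
have x_neq0 : x != 0 by apply: contraNneq D0 => x0; rewrite x0 in Dx.
rewrite rootE !hornerE subr_eq0; apply/eqP.
apply: (mulfI x_neq0); rewrite -exprS prednK ?prime_gt0 // mulr1.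
by rewrite -[RHS]expf_card F_card.
Qed.

(** For r >= 2, a double root z of Q would satisfy z = 1 - r, by eliminating a
    between Q(z) and Q'(z); then Q(z) = 0 reads a r^r = (r-1)^(r-1).  For r = 1
    this same condition is what excludes the root z = 0.  The equation for the roots is
    Q(z) = 0 divided by z^r, that is, an equation for 1 - 1/z. *)
Lemma trinomial_split_roots r (a : F) (s : seq F) : (0 < r < p)%N ->
  a != 0 -> a * r%:R ^+ r != r.-1%:R ^+ r.-1 ->
  a *: ('X - 1) ^+ r + 'X^(r.-1) %= \prod_(z <- s) ('X - z%:P) ->
  [/\ uniq s, size s = r
    & {in s, forall z, z != 0 /\ a * (1 - z^-1) ^+ r + z^-1 = 0}].
Proof.
move=> /andP[r_gt0 r_lt] a_neq0 a_neq eqQ.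
have szQ : size (a *: ('X - 1) ^+ r + 'X^(r.-1)) = r.+1.
  by rewrite size_polyDl size_scale // size_exp_XsubC // size_polyXn prednK.
have szs : size s = r.
  by have := eqp_size eqQ; rewrite szQ size_prod_XsubC => -[].
have s_root z : z \in s -> a * (z - 1) ^+ r + z ^+ r.-1 = 0.
  move=> sz; have : root (\prod_(z <- s) ('X - z%:P)) z.
    by rewrite root_prod_XsubC.
  by rewrite -(eqp_root eqQ) rootE !hornerE => /eqP.
have r_neq0 : r%:R != 0 :> F.
  by rewrite -(dvdn_pcharf p_char) gtnNdvd.
have s_neq0 z : z \in s -> z != 0.
  move=> /s_root; apply: contra_eq_neq => ->.
  move: a_neq; case: (r) r_gt0 => [//|[|m]] _ /=.
    by rewrite !expr1 expr0 mulr1 sub0r mulrN1 -subr_eq0 -oppr_eq0 opprB addrC.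
  by rewrite expr0n addr0 sub0r mulf_neq0 // expf_neq0 // oppr_eq0 oner_eq0.
split=> //; last first.
  move=> z sz; split; first exact: s_neq0.
  have z_neq0 := s_neq0 z sz.
  apply: (mulfI (expf_neq0 r z_neq0)); rewrite mulr0 -[RHS](s_root z sz) mulrDr.
  rewrite mulrCA -exprMn mulrBr mulr1 mulfV //; congr (_ + _).
  by rewrite -[r in LHS]prednK // exprSr mulfK.
rewrite -separable_prod_XsubC -(eqp_separable eqQ) unlock.
rewrite (eqp_coprimepl _ eqQ).
rewrite big_seq; elim/big_ind: _ => [|P1 P2|z sz].
- by rewrite coprime1p.
- by rewrite coprimepMl => -> ->.
(* Q splits, so it is coprime to Q' as soon as no root of Q is a root of Q'. *)
rewrite coprimep_sym coprimep_XsubC rootE; apply: contra_neqN a_neq => /eqP.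
rewrite derivD derivZ derivXn deriv_exp derivB derivX derivC subr0 mul1r !hornerE.
rewrite hornerMn !hornerE.
have z_neq0 := s_neq0 z sz; have := s_root z sz.
case: (r) r_gt0 => [//|[|m]] _ /=.
  by rewrite mulr0n horner0 addr0 expr0 mulr1 => _ a0; rewrite a0 eqxx in a_neq0.
rewrite hornerMn hornerXn => Qz.
set u := (z - 1) ^+ m.+1; set v := z ^+ m => dQz.
have {}dQz : a * (m.+2%:R * u) + m.+1%:R * v = 0 by rewrite !mulr_natl.
have z_val : z = - m.+1%:R.
  have v_neq0 : v != 0 by rewrite expf_neq0.
  apply/eqP; rewrite -subr_eq0 opprK; apply/eqP/(mulfI v_neq0).
  have -> : v * (z + m.+1%:R) = m.+2%:R * (a * ((z - 1) * u) + z * v)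
     - (z - 1) * (a * (m.+2%:R * u) + m.+1%:R * v) by rewrite [m.+2%:R]mulrS; ring.
  by rewrite /u /v -(exprS (z - 1)) -(exprS z) Qz -/u -/v dQz !mulr0 subr0.
have z1_val : z - 1 = - m.+2%:R by rewrite z_val (mulrSr 1 m.+1) opprD.
move: Qz; rewrite z1_val z_val (exprNn m.+2%:R) (exprNn m.+1%:R) (exprS (-1)).
move: (_ %:R ^+ _) (_ %:R ^+ _) => M2 M1.
set sg := (-1) ^+ m.+1 => Qz.
have sg_neq0 : sg != 0 by rewrite signr_eq0.
apply/(mulfI sg_neq0)/eqP; rewrite -subr_eq0 -oppr_eq0 -Qz; apply/eqP. ring.
Qed.

(** Translation by t preserves splitting over F_p, whereas it changes which of
    the roots is 0; the values t = 0 and t = 1 both occur below. *)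
Lemma dvdp_trinomial r (a t : F) (s : seq F) :
  (0 < r < p)%N ->
  a != 0 -> a * r%:R ^+ r != r.-1%:R ^+ r.-1 ->
  a *: ('X - 1) ^+ r + 'X^(r.-1) %= \prod_(z <- s) ('X - z%:P) ->
  a * t ^+ r - t + 1 != 0 ->
  let D := a *: ('X + t%:P) ^+ r - ('X + t%:P) + 1 in
  (1 < size D)%N /\ D %| 'X^(p.-1) - 1.
Proof.
move=> r_bnd a_neq0 a_neq eqQ Dt D.
have [s_uniq szs s_root] := trinomial_split_roots r_bnd a_neq0 a_neq eqQ.
have /andP[r_gt0 r_lt] := r_bnd.
have horner_Dt x : D.[x] = a * (x + t) ^+ r - (x + t) + 1 by rewrite !hornerE.
have [||||] := @dvdp_unity_of_roots D [seq 1 - z^-1 - t | z <- s].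
- rewrite size_map szs /D -addrA (leq_trans (size_polyD _ _)) // geq_max.
  have size_exp : size (('X + t%:P) ^+ r) = r.+1.
    by rewrite -[t]opprK polyCN size_exp_XsubC.
  rewrite (leq_trans (size_scale_leq _ _)) ?size_exp //=.
  rewrite (leq_trans (size_polyD _ _)) // size_polyN size_XaddC size_poly1 geq_max.
  by rewrite !ltnS r_gt0.
- by rewrite map_inj_uniq // => x y /addIr/addrI/oppr_inj/invr_inj.
- apply/allP=> _ /mapP[z /s_root[_ Rz] ->]; rewrite rootE horner_Dt subrK.
  by rewrite opprB addrA subrK Rz.
- by rewrite horner_Dt add0r.
by rewrite size_map szs => -> ->; rewrite ltnS.
Qed.

(** * Truncated geometric sums *)

(** Upper negation C(n,k) = (-1)^k C(k-1-n, k), with the negative integer k-1-n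
    replaced by its representative p-1-n+k modulo p. *)
Lemma natr_bin_neg n k : (k <= n < p)%N ->
  'C(n, k)%:R = (-1) ^+ k * 'C(p.-1 - n + k, k)%:R :> F.
Proof.
move=> /andP[le_kn lt_np].
have fact_neq0 : k`!%:R != 0 :> F.
  elim: k le_kn => [|k IHk] le_kn; first by rewrite oner_eq0.
  rewrite factS natrM mulf_neq0 ?IHk ?(ltnW le_kn) //.
  by rewrite -(dvdn_pcharf p_char) gtnNdvd // (leq_ltn_trans le_kn).
apply: (mulIf fact_neq0); rewrite -mulrA -!natrM !bin_ffact !ffact_prod !natr_prod.
rewrite [in RHS](reindex_inj rev_ord_inj) /=.
have -> : (-1) ^+ k = \prod_(i < k) (-1 : F) by rewrite prodr_const card_ord.
rewrite -big_split; apply: eq_bigr => i _ /=; have lt_ik := ltn_ord i.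
have -> : (p.-1 - n + k - (k - i.+1) = p - (n - i))%N by lia.
have le_np : (n - i <= p)%N by lia.
by rewrite (natrB _ le_np) (pcharf0 p_char) sub0r mulN1r opprK.
Qed.

Lemma coef_XD1_exp n j : (('X + 1) ^+ n : {poly F})`_j = 'C(n, j)%:R.
Proof.
rewrite exprD1n; under eq_bigr do rewrite -scaler_nat.
rewrite -(poly_def n.+1 (fun i => 'C(n, i)%:R)) coef_poly ltnS.
by case: leqP => // /bin_small->.
Qed.

Lemma expf_p1 (a : F) : a != 0 -> a ^+ p.-1 = 1.
Proof.
move=> a_neq0; apply: (mulfI a_neq0); rewrite -exprS prednK ?prime_gt0 // mulr1.
by rewrite -[RHS]expf_card F_card.
Qed.

Lemma sum_mul_expr0 n (f : nat -> F) : (0 < n)%N ->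
  \sum_(i < n) f i * 0 ^+ i = f 0%N.
Proof.
case: n => [//|n] _; rewrite big_ord_recl mulr1 big1 ?addr0 // => i _.
by rewrite expr0n mulr0.
Qed.

Section SplitTrinomial.
Variables (r : nat) (a : F) (s : seq F).
Hypotheses (r_bnd : (0 < r < p)%N) (a_neq0 : a != 0).
Hypothesis a_neq : a * r%:R ^+ r != r.-1%:R ^+ r.-1.
Hypothesis a_split :
  a *: ('X - 1) ^+ r + 'X^(r.-1) %= \prod_(z <- s) ('X - z%:P).

Let p_gt0 : (0 < p)%N := prime_gt0 p_pr.
Let r_gt0 : (0 < r)%N. Proof. by case/andP: r_bnd. Qed.

Lemma sum_bin_full : \sum_(k < p) 'C(r * k, k)%:R * a ^+ k = 1.
Proof.
(* W = (A^p - X^p) / (A - X), and A - X is the trinomial D_t for t = 1. *)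
pose A : {poly F} := a *: ('X + 1) ^+ r.
pose W := \sum_(i < p) A ^+ (p.-1 - i) * 'X^i.
have A_exp k : A ^+ k = a ^+ k *: ('X + 1) ^+ (r * k) by rewrite exprZn exprM.
have <- : W`_p.-1 = \sum_(k < p) 'C(r * k, k)%:R * a ^+ k.
  rewrite coef_sum (reindex_inj rev_ord_inj); apply: eq_bigr => i _ /=.
  have lt_ip := ltn_ord i.
  have -> : (p.-1 - (p - i.+1) = i)%N by lia.
  rewrite coefMXn ltnNge.
  have -> : (p - i.+1 <= p.-1)%N by lia.
  have -> : (p.-1 - (p - i.+1) = i)%N by lia.
  by rewrite A_exp coefZ coef_XD1_exp mulrC.
have [|D_gt1 D_dvd] := @dvdp_trinomial r a 1 s r_bnd a_neq0 a_neq a_split.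
  by rewrite expr1n mulr1 subrK.
pose U := a *: \sum_(i < r) ('X^p + 1) ^+ i - 1 : {poly F}.
rewrite (coef_period (c := a) (U := U) D_gt1 D_dvd).
  rewrite -horner_coef0 horner_sum.
  under eq_bigr do rewrite hornerM hornerXn horner_exp hornerZ horner_exp.
  rewrite (sum_mul_expr0 (fun i => _ ^+ (p.-1 - i))) // subn0.
  by rewrite !hornerE expr1n mulr1 expf_p1.
rewrite prednK //.
have -> : a *: ('X + 1%:P) ^+ r - ('X + 1%:P) + 1 = A - 'X :> {poly F}.
  by rewrite polyC1 -/A; ring.
have Frob : ('X + 1) ^+ p = 'X^p + 1 :> {poly F}.
  by rewrite exprDn_pchar ?expr1n // pnatE // pchar_poly.
have a_p : a ^+ p = a by rewrite -[RHS]expf_card F_card.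
have := subrX1 ('X^p + 1 : {poly F}) r; rewrite addrK => geom.
rewrite -subrXX A_exp a_p mulnC exprM Frob /U mulrBr mulr1 -scalerAr -geom.
by rewrite scalerBr alg_polyC; ring.
Qed.

Lemma sum_bin_short : \sum_(k < p | (r * k < p)%N) 'C(r * k, k)%:R * a ^+ k = 1.
Proof.
(* V = (1 - u^p) / (1 - u), and 1 - u is the trinomial D_t for t = 0. *)
pose u : {poly F} := 'X - a *: 'X^r.
pose V := \sum_(m < p) u ^+ m.
have [|D_gt1 D_dvd] := @dvdp_trinomial r a 0 s r_bnd a_neq0 a_neq a_split.
  by rewrite expr0n eqn0Ngt r_gt0 mulr0 subr0 add0r oner_eq0.
have u0 : u.[0] = 0 by rewrite !hornerE expr0n eqn0Ngt r_gt0 mulr0 oppr0.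
have V_coef : V`_p.-1 = 1.
  rewrite (coef_period (c := 1) (U := - (1 - a *: 'X^(r.-1)) ^+ p) D_gt1 D_dvd).
    rewrite -horner_coef0 horner_sum.
    under eq_bigr do rewrite horner_exp u0 -[_ ^+ _]mul1r.
    by rewrite (sum_mul_expr0 (fun=> 1)).
  rewrite prednK // mulrN -exprMn mulrBr mulr1 -scalerAr -exprS prednK // -/u.
  have -> : a *: ('X + 0%:P) ^+ r - ('X + 0%:P) + 1 = - (u - 1) :> {poly F}.
    by rewrite addr0 !opprB addrC.
  by rewrite mulNr -subrX1 opprB.
have u_exp m : (m < p)%N ->
    u ^+ m = \sum_(k < p) ((- a) ^+ k * 'C(m, k)%:R) *: 'X^(m + r.-1 * k).
  move=> lt_mp.
  have -> : u = 'X * ((- a) *: 'X^(r.-1) + 1).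
    by rewrite mulrDr mulr1 -scalerAr -exprS prednK // scaleNr addrC.
  rewrite exprMn exprD1n.
  rewrite (big_ord_widen p (fun i => ((- a) *: 'X^(r.-1)) ^+ i *+ 'C(m, i))) //.
  rewrite big_mkcond mulr_sumr; apply: eq_bigr => k _.
  rewrite exprZn -exprM -scaler_nat scalerA ltnS.
  case: leqP => [_|/bin_small ->]; last by rewrite mulr0 mulr0 scale0r.
  by rewrite -scalerAr -exprD mulrC.
apply: esym; rewrite -[LHS]V_coef coef_sum.
transitivity (\sum_(m < p) \sum_(k < p)
    (- a) ^+ k * 'C(m, k)%:R * (p.-1 == m + r.-1 * k)%N%:R).
  apply: eq_bigr => m _; rewrite u_exp // coef_sum; apply: eq_bigr => k _.
  by rewrite coefZ coefXn.
(* For fixed k only m = p-1-(r-1)k contributes; it is at least k iff rk < p. *)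
rewrite exchange_big [RHS]big_mkcond; apply: eq_bigr => k _ /=.
case: ltnP => rk_p.
  have m_lt : (p.-1 - r.-1 * k < p)%N by lia.
  rewrite (bigD1 (Ordinal m_lt)) //= big1 => [|m m_neq]; last first.
    case: eqP => [e|_]; last by rewrite mulr0.
    by rewrite -val_eqE /= e addnK eqxx in m_neq.
  have lt_kp := ltn_ord k.
  have -> : (p.-1 == p.-1 - r.-1 * k + r.-1 * k)%N by nia.
  rewrite (@natr_bin_neg (r * k)); last by nia.
  have -> : (p.-1 - r * k + k = p.-1 - r.-1 * k)%N by nia.
  by rewrite addr0 mulr1 (exprNn a) mulrAC.
rewrite big1 // => m _; case: eqP => [e|_]; last by rewrite mulr0.
rewrite bin_small ?mulr0 ?mul0r //; have := ltn_ord m; nia.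
Qed.

End SplitTrinomial.
End PrimeField.

(** * The two congruences *)

Theorem corollary8 (p r : nat) (a : padic_int p)
  (p_prime : prime p) (p_odd : odd p) (r_range : (1 <= r < p)%N)
  (a_neq0 : ~ padic_eqmodp a 0)
  (a_neq : ~ padic_eqmodp a (r.-1%:R ^+ r.-1 / r%:R ^+ r))
  (a_split : exists s : seq 'F_p,
     padic_residue a *: ('X - 1) ^+ r + 'X^(r.-1)
       %= \prod_(z <- s) ('X - z%:P)) :
  padic_eqmodp (\sum_(1 <= k < p) 'C(r * k, k)%:R * a ^+ k) 0 /\
  padic_eqmodp
    (\sum_(1 <= k < p | (k%:R < p%:R / r%:R :> rat)) 'C(r * k, k)%:R * a ^+ k) 0.
Proof.
have p_char := pchar_Fp p_prime; have F_card := card_Fp p_prime.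
have p_gt0 := prime_gt0 p_prime; have r_gt0 : (0 < r)%N by case/andP: r_range.
case: a_split => s; set al := padic_residue a => al_split.
have al_neq0 : al != 0.
  apply/eqP => al0; apply: a_neq0.
  by apply: padic_eqmodp_residue => //; rewrite rmorph0.
have al_neq : al * r%:R ^+ r != r.-1%:R ^+ r.-1.
  apply/eqP => al_eq; apply: a_neq; apply: padic_eqmodp_residue => //.
  have r_unit := padic_natr_unit p_prime r_range.
  have rX_unit : (r%:R ^+ r : 'F_p) \is a GRing.unit.
    by rewrite unitrX // unitfE -(dvdn_pcharf p_char) gtnNdvd //; case/andP: r_range.
  rewrite rmorphM rmorphV ?unitrX // !rmorphXn !rmorph_nat.
  by rewrite -[LHS](mulrK rX_unit) al_eq.
have term k : padic_residue ('C(r * k, k)%:R * a ^+ k) = 'C(r * k, k)%:R * al ^+ k.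
  by rewrite rmorphM rmorphXn rmorph_nat.
(* Both sums start at k = 1, so the term 1 of index 0 is added to both sides. *)
split; apply: padic_eqmodp_residue => //; rewrite rmorph0 rmorph_sum /=.
  rewrite (eq_bigr _ (fun k _ => term k)); apply: (addrI 1); rewrite addr0.
  rewrite -[RHS](sum_bin_full p_char F_card r_range al_neq0 al_neq al_split).
  rewrite -(big_mkord xpredT (fun k => 'C(r * k, k)%:R * al ^+ k)).
  by rewrite [RHS]big_ltn // muln0 bin0 mulr1.
rewrite (eq_bigr _ (fun k _ => term k)); apply: (addrI 1); rewrite addr0.
rewrite -[RHS](sum_bin_short p_char F_card r_range al_neq0 al_neq al_split).
rewrite -(big_mkord (fun k => (r * k < p)%N) (fun k => 'C(r * k, k)%:R * al ^+ k)).
rewrite [RHS]big_ltn_cond // muln0 p_gt0 bin0 mulr1; congr (_ + _).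
apply: eq_bigl => k; rewrite ltr_pdivlMr ?ltr0n //.
by rewrite -natrM ltr_nat mulnC.
Qed.
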